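(* Let $\mathcal{X},\mathcal{Y}$ be complex Banach spaces, $A\in B(\mathcal{X})$, $B\in B(\mathcal{Y})$, let $C:\mathcal{Y}\to\mathcal{X}$ be a bounded operator, and let $$M=\begin{pmatrix}A&C\\0&B\end{pmatrix}$$ act on $\mathcal{X}\oplus\mathcal{Y}$. Assume $\sigma(A)\cap\sigma(B)=\emptyset$ and let $\varepsilon>0$ satisfy $\varepsilon<\operatorname{dist}(\sigma(A),\sigma(B))/2$. Then there exists a rational function $r=p/q$ such that $p$ has distinct roots, $\deg q<\deg p$, and such that the components of the lemniscate set $$V=\{z\in\mathbb{C}:|r(z)|<1\}$$ can be grouped into three disjoint sets, $V=V_1\cup V_2\cup V_0$ (each $V_i$ being a union of connected components of $V$), where $\sigma(A)\Subset V_1$, $\sigma(B)\Subset V_2$, while $V_0$, which may be empty, satisfies $V_0\cap\sigma(M)=\emptyset$. Further, $\operatorname{dist}(V_i,V_j)\ge\varepsilon/2$ for $i\neq j$.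
   Context: $\sigma(\cdot)$ denotes the spectrum. A rational function is written $r=p/q$ with complex polynomials $p,q$ having no common roots; at a pole $|r(z)|=\infty$. The notation $S\Subset V$ means that the compact set $S$ is contained in the interior of $V$. The distance to the empty set is taken to be $+\infty$. *)

(* Defs.v *)
From HB Require Import structures.
From mathcomp Require Import all_boot all_order all_algebra.
From mathcomp Require Import complex.
From mathcomp Require Import all_classical all_reals all_analysis.

Set Implicit Arguments.
Unset Strict Implicit.
Unset Printing Implicit Defensive.

Import Order.TTheory GRing.Theory Num.Theory.
Import numFieldNormedType.Exports.

Local Open Scope classical_set_scope.
Local Open Scope ring_scope.

(* R[i] itself carries no topology; its packed numClosedFieldType does, namely
   the one induced by the norm. *)
Definition cplx (R : realType) : numClosedFieldType := R[i].

Definition bounded_op (K : numFieldType) (X Y : normedModType K) (T : X -> Y) :=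
  exists2 k : K, 0 <= k & forall x, `|T x| <= k * `|x|.

Section spectrum.
Context {K : numFieldType} {X : normedModType K}.

Definition resolvent_set (T : {linear X -> X}) : set K :=
  [set l | exists S : {linear X -> X},
    [/\ bounded_op S,
        forall x, S (l *: x - T x) = x &
        forall x, l *: S x - T (S x) = x]].

Definition spectrum (T : {linear X -> X}) : set K := ~` resolvent_set T.

End spectrum.

Section upper_triangular.
Context {K : numFieldType} {X Y : normedModType K}.
Variables (A : {linear X -> X}) (B : {linear Y -> Y}) (C : {linear Y -> X}).

(* The operator matrix (A C \\ 0 B); X * Y carries the max norm. *)
Definition upper_triangular (z : X * Y) : X * Y := (A z.1 + C z.2, B z.2).

Lemma upper_triangular_is_linear : linear upper_triangular.
Proof.
move=> a [x1 y1] [x2 y2]; rewrite /upper_triangular /=; congr pair.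
  by rewrite !linearP /= scalerDr addrACA.
by rewrite linearP.
Qed.

HB.instance Definition _ :=
  GRing.isLinear.Build K (X * Y)%type (X * Y)%type *:%R upper_triangular
    upper_triangular_is_linear.

End upper_triangular.

Definition compactly_contained (T : topologicalType) (S V : set T) :=
  compact S /\ S `<=` V°.

Definition union_of_components (T : topologicalType) (V W : set T) :=
  exists2 I : set T, I `<=` V & W = \bigcup_(x in I) connected_component V x.

Section complex_plane.
Context {R : realType}.
Local Notation C := (cplx R).

(* Equal to +oo when S or T is empty. *)
Definition set_dist (S T : set C) : \bar R :=
  ereal_inf [set (complex.Re `|x - y|)%:E | x in S & y in T].

Definition rational_pair (p q : {poly C}) :=
  q != 0 /\ forall z, ~~ (root p z && root q z).

Definition distinct_roots (p : {poly C}) := forall z, root p z -> mup z p = 1%N.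

(* |r| = +oo at a pole, so poles are excluded; the division of MathComp would
   give 0 there. *)
Definition lemniscate (p q : {poly C}) : set C :=
  [set z | q.[z] != 0 /\ `|p.[z] / q.[z]| < 1].

End complex_plane.

(* Main.v *)
Require Import Defs.
From HB Require Import structures.
From mathcomp Require Import all_boot all_order all_algebra.
From mathcomp Require Import complex.
From mathcomp Require Import all_classical all_reals all_analysis.
From mathcomp Require Import zify ring lra.

Set Implicit Arguments.
Unset Strict Implicit.
Unset Printing Implicit Defensive.

Import Order.TTheory GRing.Theory Num.Theory.
Import numFieldNormedType.Exports.

Local Open Scope classical_set_scope.
Local Open Scope ring_scope.

(** With V_0 empty, it suffices to find r with |r| < 1 on
    K = sigma(A) U sigma(B) and |r| >= 1 at every point whose distance to K is
    at least 3 eps / 4.  The lemniscate then splits into its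
    traces on the open 3 eps / 4 neighborhoods of the two spectra; these
    neighborhoods are more than 2 eps - 3 eps / 2 = eps / 2 apart, so each
    trace is open and closed in V and hence a union of components.

    Put r = 1 / f with f = sum_j c_j / (z - a_j), the a_j distinct and the c_j
    nonzero.  Then r = p / q where p has the simple roots a_j and
    deg q < deg p, and what is wanted is |f| > 1 on K and |f| <= 1 far from K.
    The indicator function of K suggests f: by Cauchy's formula it is
    the integral of d zeta / (zeta - z) over a cycle around K, up to a
    constant.  That integral is replaced by a very coarse Riemann sum.  Cover
    K by the squares of a fine grid that are close to K, and take one node at
    the midpoint of each side (cell_sum).  Three facts replace
    the theory of contour integrals.

    - The sum over the four sides of one square is, in units of the mesh,
      - (i/2) / (t^4 - 1/16), where t goes from the center of the square to
      z (cell_sum_inv_le).  Since 1/|t|^4 is summable over the lattice, the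
      squares at distance at least m from z contribute O(1/m^2) altogether,
      whichever squares they are (lattice_sum_far).

    - The nodes on a side shared by two squares cancel, so the sum over a block
      of (2m+1)^2 squares reduces to the boundary of the block
      (block_telescope).  If z is near the center of the block, all boundary
      terms have a positive imaginary part, of total at least 1
      (block_sum_near).

    - Consequently f is close to 0 away from the chosen squares, and bounded
      away from 0 at the points that are surrounded by a whole block of them.
      A fixed value of m is enough, and no limit is taken.

    The four terms of a square are kept for an arbitrary kernel k in place of
    the inverse.  With k the indicator of 0, the same cancellations show that
    no point of K is a pole of f (lattice_sum_near).

    What the spectra contribute is compactness: they are bounded and closed by
    the Neumann series (resolvent_set_gt_bound, open_resolvent_set). *)

(** * Spectra are bounded and closed *)

Section bounded_operators.
Variable R : realType.
Local Notation C := (cplx R).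

Lemma geometric_small (c k e : C) : 0 <= c -> 0 <= k -> k < 1 -> 0 < e ->
  exists n, c * k ^+ n < e.
Proof.
case: c k e => [c c'] [k k'] [e e'].
rewrite !lecE !ltcE /= => /andP[/eqP -> c0] /andP[/eqP -> k0] /andP[_ k1].
move=> /andP[/eqP -> e0].
have c1 : 0 < c + 1 by lra.
have /cvg_expr/cvgrPdist_lt/(_ (e / (c + 1))) : `|k| < 1 by rewrite ger0_norm.
move=> /(_ (divr_gt0 e0 c1)) [n _ /(_ n (leqnn n))].
rewrite sub0r normrN ger0_norm ?exprn_ge0// ltr_pdivlMr// => ken.
exists n; have -> : (c +i* 0)%C * (k +i* 0)%C ^+ n = (c * k ^+ n)%:C%C.
  by rewrite (rmorphM (real_complex R)) rmorphXn.
rewrite ltcR (le_lt_trans _ ken)// mulrC ler_wpM2l ?exprn_ge0//; lra.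
Qed.

(** The partial sums of the Neumann series are the iterates of
    x |-> y + T x from 0; they form a Cauchy sequence with geometric rate k. *)
Lemma affine_contraction_fixpoint (X : completeNormedModType C)
    (T : {linear X -> X}) (k : C) : 0 <= k -> k < 1 ->
  (forall x, `|T x| <= k * `|x|) -> forall y, exists x, x = y + T x.
Proof.
move=> k0 k1 Tk y.
pose u n := iter n (fun x => y + T x) 0.
have uS n : u n.+1 = y + T (u n) by [].
have du n m : `|u (n + m)%N - u n| <= k ^+ n * `|u m|.
  elim: n => [|n IH]; first by rewrite add0n subr0 expr0 mul1r.
  rewrite addSn !uS opprD addrACA subrr add0r -linearB (le_trans (Tk _))//.
  by rewrite exprS -mulrA ler_wpM2l.
have k1' : 0 < 1 - k by rewrite subr_gt0.
have bu m : `|u m| <= `|y| / (1 - k).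
  rewrite ler_pdivlMr//; elim: m => [|m IH]; first by rewrite normr0 mul0r.
  rewrite uS (le_trans (ler_wpM2r (ltW k1') (ler_normD _ _)))// mulrDl.
  rewrite [leRHS](_ : _ = `|y| * (1 - k) + k * `|y|); last by ring.
  rewrite lerD2l -subr_ge0.
  have -> : k * `|y| - `|T (u m)| * (1 - k) =
            k * (`|y| - `|u m| * (1 - k)) + (k * `|u m| - `|T (u m)|) * (1 - k).
    by ring.
  by rewrite addr_ge0// mulr_ge0// ?subr_ge0// ltW.
have c0 : 0 <= `|y| / (1 - k) by rewrite divr_ge0// ltW.
have cu : cauchy (u @ \oo).
  apply: cauchy_exP => e e0.
  have [n kn] := geometric_small c0 k0 k1 e0.
  exists (u n); exists n => // m /= nm; rewrite -ball_normE /= distrC.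
  rewrite -(subnKC nm) (le_lt_trans _ kn)// (le_trans (du _ _))//.
  by rewrite mulrC ler_wpM2r// exprn_ge0.
have [l ul] : exists l : X, u @ \oo --> l by exists (lim (u @ \oo)); exact: cauchy_cvg.
exists l; have ul1 : u n.+1 @[n --> \oo] --> l by rewrite cvg_shiftS.
apply: (cvg_unique _ ul1); first exact: norm_hausdorff.
apply/cvgrPdist_lt => e e0.
move/cvgrPdist_lt/(_ _ e0): ul; apply: filterS => n; apply: le_lt_trans.
rewrite uS opprD addrACA subrr add0r -linearB (le_trans (Tk _))//.
by rewrite ler_piMl// ltW.
Qed.

(** Surjectivity is all that remains to be checked for invertibility once L is
    bounded below: the lower bound gives injectivity and bounds the inverse. *)
Lemma bounded_below_inverse (X : normedModType C) (L : {linear X -> X}) (c : C) :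
  0 < c -> (forall x, c * `|x| <= `|L x|) -> (forall y, exists x, L x = y) ->
  exists S : {linear X -> X},
    [/\ bounded_op S, cancel L S & cancel S L].
Proof.
move=> c0 cL surj; have [S SL] := choice surj.
have inj : injective L.
  move=> x y xy; apply/eqP; rewrite -subr_eq0 -normr_le0.
  have := cL (x - y); rewrite linearB xy subrr normr0.
  by rewrite pmulr_rle0.
have linS : linear S by move=> a x y; apply: inj; rewrite linearP !SL.
pose Sl : {linear X -> X} := HB.pack S (GRing.isLinear.Build C X X *:%R S linS).
exists Sl; split => //; last by move=> x; apply: inj; rewrite SL.
exists c^-1; first by rewrite invr_ge0 ltW.
by move=> x; rewrite mulrC ler_pdivlMr// mulrC (le_trans (cL _))// SL.
Qed.

Lemma mem_resolvent_set (X : normedModType C) (T : {linear X -> X}) (l c : C) :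
  0 < c -> (forall x, c * `|x| <= `|l *: x - T x|) ->
  (forall y, exists x, l *: x - T x = y) -> resolvent_set T l.
Proof.
move=> c0 cL surj; pose L x := l *: x - T x.
have linL : linear L.
  move=> a x y; rewrite /L (linearP T) scalerDr opprD addrACA scalerBr.
  by rewrite !scalerA mulrC.
pose Ll : {linear X -> X} := HB.pack L (GRing.isLinear.Build C X X *:%R L linL).
have [S [? ? ?]] := @bounded_below_inverse X Ll c c0 cL surj.
by exists S.
Qed.

(** l - T = l (1 - T / l), and T / l is a contraction. *)
Lemma resolvent_set_gt_bound (X : completeNormedModType C)
    (T : {linear X -> X}) (k l : C) : 0 <= k ->
  (forall x, `|T x| <= k * `|x|) -> k < `|l| -> resolvent_set T l.
Proof.
move=> k0 Tk kl; have l0 : 0 < `|l| by exact: le_lt_trans kl.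
have l_neq0 : l != 0 by rewrite -normr_gt0.
apply: (@mem_resolvent_set _ _ _ (`|l| - k)); first by rewrite subr_gt0.
  move=> x; rewrite mulrBl -normrZ (le_trans _ (lerB_dist _ _))//.
  by rewrite lerD2l lerN2.
move=> y; pose U := l^-1 \*: T.
have [|||x xE] := @affine_contraction_fixpoint X U (k / `|l|) _ _ _ (l^-1 *: y).
- by rewrite divr_ge0// ltW.
- by rewrite ltr_pdivrMr// mul1r.
- move=> x; rewrite /U /= normrZ normfV mulrAC [leRHS]mulrC.
  by rewrite ler_wpM2l// invr_ge0 ltW.
exists x; rewrite {1}xE /U /= scalerDr !scalerA divff// !scale1r addrK//.
Qed.

(** With S = (l - T)^-1, solving (m - T) x = y amounts to finding a fixed point
    z = y + (l - m) S z and putting x = S z; for m close to l this is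
    a contraction. *)
Lemma open_resolvent_set (X : completeNormedModType C) (T : {linear X -> X}) :
  open (resolvent_set T).
Proof.
rewrite openE => l [S [[M M0 SM] SL LS]].
have M1 : 0 < M + 1 by rewrite ltr_wpDl.
apply/nbhs_ballP; exists (M + 1)^-1 => /=; first by rewrite invr_gt0.
move=> m; rewrite -ball_normE /= => lm.
have d1 : `|l - m| * M < 1.
  rewrite (@le_lt_trans _ _ (`|l - m| * (M + 1)))//; last first.
    by rewrite -ltr_pdivlMr// mul1r.
  by rewrite ler_wpM2l// lerDl.
apply: (@mem_resolvent_set _ _ _ ((1 - `|l - m| * M) / (M + 1))).
- by rewrite divr_gt0// subr_gt0.
- move=> x; rewrite mulrAC ler_pdivrMr// mulrBl mul1r lerBlDr.
  have {1}<- : S ((m *: x - T x) + (l - m) *: x) = x.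
    by rewrite scalerBl addrAC subrKC SL.
  rewrite (le_trans (SM _))//.
  have -> : M * `|m *: x - T x + (l - m) *: x| <=
    `|m *: x - T x| * (M + 1) + `|l - m| * M * `|x| => //.
  rewrite (le_trans (ler_wpM2l M0 (ler_normD _ _)))// mulrDr normrZ lerD//.
    by rewrite mulrC ler_wpM2l// lerDl.
  by rewrite mulrA [M * _]mulrC.
- move=> y; pose U := (l - m) \*: S.
  have [|||z zE] := @affine_contraction_fixpoint X U (`|l - m| * M) _ _ _ y.
  + by rewrite mulr_ge0.
  + exact: d1.
  + by move=> x; rewrite /U /= normrZ -mulrA ler_wpM2l.
  exists (S z); apply: (addIr ((l - m) *: S z)).
  by rewrite -[RHS]zE scalerBl addrAC subrKC LS.
Qed.

Lemma closed_spectrum (X : completeNormedModType C) (T : {linear X -> X}) :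
  closed (spectrum T).
Proof. exact/open_closedC/open_resolvent_set. Qed.

Lemma spectrum_le_bound (X : completeNormedModType C) (T : {linear X -> X}) :
  bounded_op T -> exists2 k : C, 0 <= k & forall l, spectrum T l -> `|l| <= k.
Proof.
move=> [k k0 Tk]; exists k => // l; apply: contraPT.
rewrite -real_ltNge// ?ger0_real// => kl; apply.
exact: resolvent_set_gt_bound kl.
Qed.

End bounded_operators.

(** * Midpoint sums over the cells of a lattice *)

Section lattice.
Variable R : realType.
Local Notation C := (cplx R).

(** The function G u = u / (M (M + |u|)) has total variation 2 / M, and its
    increments over unit intervals dominate 1 / (M^2 + u^2) up to
    a factor 4; this replaces a comparison with the integral of
    1 / (M^2 + u^2). *)
Lemma inv_step (M u : R) : 1 <= M ->
  (M ^+ 2 + u ^+ 2)^-1 <=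
  4 * ((u + 1) / (M * (M + `|u + 1|)) - u / (M * (M + `|u|))).
Proof.
move=> M1.
have D0 : 0 < M ^+ 2 + u ^+ 2 by nra.
have [u0|u0] := leP 0 u.
  rewrite !ger0_norm//; last by lra.
  have -> : (u + 1) / (M * (M + (u + 1))) - u / (M * (M + u)) =
            ((M + u) * (M + u + 1))^-1.
    by field; repeat (apply/andP; split); apply: lt0r_neq0; lra.
  rewrite -[leRHS]invrK lef_pV2 ?posrE//; last first.
    by rewrite invr_gt0 mulr_gt0// invr_gt0 mulr_gt0//; lra.
  rewrite invfM invrK ler_pdivrMl//; have := sqr_ge0 (M - u).
  have : 0 <= (M + u) * (M + u - 1) by apply: mulr_ge0; lra.
  by rewrite !expr2; lra.
have [u1|u1] := leP u (-1).
  rewrite !ler0_norm//; [|by lra|by lra].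
  have -> : (u + 1) / (M * (M - (u + 1))) - u / (M * (M - u)) =
            ((M - u) * (M - u - 1))^-1.
    by field; repeat (apply/andP; split); apply: lt0r_neq0; lra.
  rewrite -[leRHS]invrK lef_pV2 ?posrE//; last first.
    by rewrite invr_gt0 mulr_gt0// invr_gt0 mulr_gt0//; lra.
  rewrite invfM invrK ler_pdivrMl//; have := sqr_ge0 (M + u).
  have : 0 <= (M - u) * (M - u + 1) by apply: mulr_ge0; lra.
  by rewrite !expr2; lra.
rewrite gtr0_norm; last by lra.
rewrite ltr0_norm//.
apply: (@le_trans _ _ (4 * ((u + 1) / (M * (M + 1)) - u / (M * (M + 1))))).
  have -> : (u + 1) / (M * (M + 1)) - u / (M * (M + 1)) = (M * (M + 1))^-1.
    by field; repeat (apply/andP; split); apply: lt0r_neq0; lra.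
  rewrite -[leRHS]invrK lef_pV2 ?posrE//; last first.
    by rewrite invr_gt0 mulr_gt0// invr_gt0 mulr_gt0//; lra.
  rewrite invfM invrK ler_pdivrMl//; have := sqr_ge0 u.
  have : 0 <= M * (M - 1) by apply: mulr_ge0; lra.
  by rewrite !expr2; lra.
rewrite ler_pM2l// lerB//.
  rewrite ler_wpM2l//; first by lra.
  by rewrite lef_pV2 ?posrE ?mulr_gt0// ?ler_pM2l//; lra.
rewrite ler_wnM2l//; first by lra.
by rewrite lef_pV2 ?posrE ?mulr_gt0// ?ler_pM2l//; lra.
Qed.

Lemma sum_inv_le (M x : R) n : 1 <= M ->
  \sum_(0 <= i < n) (M ^+ 2 + (x - i%:R) ^+ 2)^-1 <= 8 / M.
Proof.
move=> M1; pose G u := u / (M * (M + `|u|)).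
have G1 u : `|G u| <= M^-1.
  rewrite normrM normfV normrM (gtr0_norm (_ : 0 < M)); last by lra.
  rewrite (gtr0_norm (_ : 0 < M + `|u|)); last by have := normr_ge0 u; lra.
  rewrite ler_pdivrMr; last by have := normr_ge0 u; nra.
  rewrite mulKf; last by apply: lt0r_neq0; lra.
  by lra.
apply: (@le_trans _ _ (\sum_(0 <= i < n) 4 * (G (i.+1%:R - x) - G (i%:R - x)))).
  apply: ler_sum => i _; rewrite -(sqrrN (x - _)) opprB.
  have := inv_step (i%:R - x) M1; rewrite /G -(natr1 i).
  by rewrite (addrAC i%:R 1 (- x)).
rewrite -mulr_sumr telescope_sumr//.
have := G1 (n%:R - x); have := G1 (0%:R - x).
by rewrite !ler_norml => /andP[? ?] /andP[? ?]; lra.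
Qed.

(** The midpoint Riemann sum of - k(z - zeta) d zeta over the boundary, run
    counterclockwise, of the unit square with center z - (a + i b). *)
Definition cell_sum (k : C -> C) (a b : R) : C :=
  k (a +i* (b - 2^-1))%C - k (a +i* (b + 2^-1))%C
  + 'i%C * (k ((a + 2^-1) +i* b)%C - k ((a - 2^-1) +i* b)%C).

Lemma sqr_normc_complex (a b : R) : `|(a +i* b)%C : C| ^+ 2 = (a ^+ 2 + b ^+ 2)%:C%C.
Proof. by rewrite -(add_Re2_Im2 (a +i* b)%C). Qed.

(** The four terms combine to - (i/2) / (t^4 - 1/16): the parts of order 1/t,
    1/t^2 and 1/t^3 cancel, which is what makes the sum over all
    squares of a lattice absolutely convergent. *)
Lemma cell_sum_inv_le (a b : R) : 1 <= a ^+ 2 + b ^+ 2 ->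
  `|cell_sum GRing.inv a b| <= ((a ^+ 2 + b ^+ 2) ^- 2)%:C%C.
Proof.
move=> ab1; pose t : C := (a +i* b)%C.
(* The nodes are at t -+ u and t -+ v; u and v are kept abstract for the
   sake of the field identities. *)
have [u uE] : exists u : C, u = (0 +i* 2^-1)%C by eexists.
have [v vE] : exists v : C, v = (2^-1)%:C%C by eexists.
have n2 : `|t ^+ 2| = (a ^+ 2 + b ^+ 2)%:C%C by rewrite normrX sqr_normc_complex.
have v2 : v ^+ 2 = (4^-1)%:C%C.
  by rewrite vE -(rmorphXn (real_complex R)); congr (_ %:C)%C; field.
have u2 : u ^+ 2 = - v ^+ 2.
  by rewrite v2 uE expr2; apply/eqP; rewrite eq_complex /=; apply/andP; split;
     apply/eqP; field.
have t1 : 1 <= `|t ^+ 2| by rewrite n2 lecR.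
have norm_v2 : `|v ^+ 2| = (4^-1)%:C%C.
  by rewrite v2 normc_def /= expr0n addr0 sqrtr_sqr ger0_norm.
have quarter : (4^-1)%:C%C < `|t ^+ 2|.
  by rewrite n2 ltcR (lt_le_trans _ ab1)//; lra.
have nz (w : C) : `|w ^+ 2| = (4^-1)%:C%C -> (t - w != 0) * (t + w != 0).
  move=> w4; suff : t ^+ 2 - w ^+ 2 != 0.
    by rewrite subr_sqr mulf_eq0 negb_or => /andP[-> ->].
  by apply: contraTneq quarter => /subr0_eq ->; rewrite w4 ltxx.
have nv := nz _ norm_v2.
have nu : (t - u != 0) * (t + u != 0) by apply: nz; rewrite u2 normrN.
have -> : cell_sum GRing.inv a b = - u / ((t ^+ 2) ^+ 2 - (v ^+ 2) ^+ 2).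
  have -> : cell_sum GRing.inv a b =
      (t - u)^-1 - (t + u)^-1 + (u + u) * ((t + v)^-1 - (t - v)^-1).
    rewrite /cell_sum uE vE; congr (_^-1 - _^-1 + _ * (_^-1 - _^-1));
    by apply/eqP; rewrite eq_complex /=; apply/andP; split; apply/eqP; field.
  have vv : v + v = 1.
    by rewrite vE; apply/eqP; rewrite eq_complex /= addr0 eqxx andbT -div1r -splitr.
  have -> : (t - u)^-1 - (t + u)^-1 = (u + u) / (t ^+ 2 - u ^+ 2).
    by field; rewrite !nu subr_sqr mulf_neq0 ?nu.
  have -> : (t + v)^-1 - (t - v)^-1 = - (v + v) / (t ^+ 2 - v ^+ 2).
    by field; rewrite !nv subr_sqr mulf_neq0 ?nv.
  have V4 : 4 * v ^+ 2 = 1.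
    by transitivity ((v + v) ^+ 2); [ring|rewrite vv expr1n].
  have nV : t ^+ 2 - v ^+ 2 != 0 by rewrite subr_sqr mulf_neq0 ?nv.
  have nU : t ^+ 2 + v ^+ 2 != 0.
    by rewrite -[v ^+ 2]opprK -u2 subr_sqr mulf_neq0 ?nu.
  rewrite vv u2 -[in RHS](mulr1 u) -[in RHS]V4.
  by field; rewrite nV opprK nU subr_sqr mulf_neq0.
set tau := a ^+ 2 + b ^+ 2 in n2 ab1 *.
have D : (tau ^+ 2 / 2)%:C%C <= `|(t ^+ 2) ^+ 2 - (v ^+ 2) ^+ 2|.
  apply: le_trans (lerB_dist _ _); rewrite normrX n2 [`|(v ^+ 2) ^+ 2|]normrX.
  rewrite norm_v2 -!(rmorphXn (real_complex R)) -rmorphB lecR.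
  have : 1 <= tau ^+ 2 by rewrite exprn_ege1.
  lra.
have tau2 : 0 < tau ^+ 2 by rewrite exprn_gt0//; lra.
have N4 : 0 < `|(t ^+ 2) ^+ 2 - (v ^+ 2) ^+ 2|.
  by apply: lt_le_trans D; rewrite ltcR divr_gt0.
have nu2 : `|u| = (2^-1)%:C%C.
  by rewrite uE normc_def /= expr0n add0r sqrtr_sqr ger0_norm.
rewrite normrM normfV normrN ler_pdivrMr// nu2.
have /(ler_wpM2l _) := D; move=> /(_ (tau ^- 2)%:C%C).
rewrite lecR invr_ge0 ltW// => /(_ isT); apply: le_trans.
by rewrite -rmorphM lecR mulrA mulVf ?mul1r// gt_eqF.
Qed.


(** Summing along columns for the horizontal sides and along rows for the
    vertical ones, only the sides on the boundary of the block survive. *)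
Lemma block_telescope (k : C -> C) (x y : R) (I J L : nat) :
  \sum_(I <= i < I + L) \sum_(J <= j < J + L) cell_sum k (x - i%:R) (y - j%:R) =
  \sum_(I <= i < I + L) (k ((x - i%:R) +i* (y - (J + L)%:R + 2^-1))%C
                        - k ((x - i%:R) +i* (y - J%:R + 2^-1))%C)
  + 'i%C * \sum_(J <= j < J + L) (k ((x - I%:R + 2^-1) +i* (y - j%:R))%C
                        - k ((x - (I + L)%:R + 2^-1) +i* (y - j%:R))%C).
Proof.
rewrite /cell_sum; under eq_bigr do rewrite big_split /=.
rewrite big_split /=; congr (_ + _).
  apply: eq_bigr => i _.
  rewrite -(@telescope_sumr _ _ _ (fun j => k ((x - i%:R) +i* (y - j%:R + 2^-1))%C) (leq_addr _ _)).
  by apply: eq_bigr => j _; congr (k (_ +i* _)%C - _); rewrite -natr1; field.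
rewrite exchange_big mulr_sumr /=; apply: eq_bigr => j _.
rewrite -mulr_sumr; congr (_ * _).
rewrite -[RHS]opprB.
rewrite -(@telescope_sumr _ _ _ (fun i => k ((x - i%:R + 2^-1) +i* (y - j%:R))%C) (leq_addr _ _)).
rewrite -sumrN.
by apply: eq_bigr => i _; rewrite opprB; congr (_ - k (_ +i* _)%C); rewrite -natr1; field.
Qed.

(** Putting this kernel in place of the inverse turns a combination of the
    1 / (z - a_j) into the total coefficient of the pole z. *)
Definition dirac0 (t : C) : C := (t == 0)%:R.

Lemma cell_sum_dirac0 (a b : R) : 1 <= a ^+ 2 + b ^+ 2 ->
  cell_sum dirac0 a b = 0.
Proof.
move=> ab1; have z (a' b' : R) : a' ^+ 2 + b' ^+ 2 != 0 -> dirac0 (a' +i* b')%C = 0.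
  move=> h; rewrite /dirac0 eq_complex /=; case: andP => // -[/eqP a0 /eqP b0].
  by rewrite a0 b0 expr0n addr0 eqxx in h.
rewrite /cell_sum !z ?subr0 ?mulr0 ?addr0//; apply: lt0r_neq0.
all: have := sqr_ge0 a; have := sqr_ge0 b.
all: have := sqr_ge0 (a - 1); have := sqr_ge0 (a + 1).
all: have := sqr_ge0 (b - 1); have := sqr_ge0 (b + 1).
all: rewrite !expr2 in ab1 *; lra.
Qed.

Definition lattice_sum (k : C -> C) n (s : nat -> nat -> bool) (x y : R) : C :=
  \sum_(0 <= i < n) \sum_(0 <= j < n | s i j) cell_sum k (x - i%:R) (y - j%:R).

(** If m <= |t|, then |t|^4 >= (m^2 + a^2) (m^2 + b^2) / 4 for t = a + i b, so
    that the double series is bounded by a product of two simple series, each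
    at most 8 / m. *)
Lemma lattice_sum_far (m n : nat) (s : nat -> nat -> bool) (x y : R) :
  (32 <= m)%N ->
  (forall i j, s i j -> m%:R ^+ 2 <= (x - i%:R) ^+ 2 + (y - j%:R) ^+ 2) ->
  `|lattice_sum GRing.inv n s x y| <= (4^-1)%:C%C /\
  lattice_sum dirac0 n s x y = 0.
Proof.
rewrite -(ler_nat R) => m32 far; set M : R := m%:R in m32 far.
have M2 : 1 <= M ^+ 2 by rewrite exprn_ege1//; lra.
split; last first.
  apply: big1 => i _; apply: big1 => j /far ij.
  exact/cell_sum_dirac0/(le_trans M2).
pose g (z : R) (i : nat) := (M ^+ 2 + (z - i%:R) ^+ 2)^-1.
have g0 z i : 0 < M ^+ 2 + (z - i%:R) ^+ 2.
  by rewrite ltr_pwDl ?sqr_ge0//; lra.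
have bnd i j : s i j ->
    `|cell_sum GRing.inv (x - i%:R) (y - j%:R)| <= (4 * (g x i * g y j))%:C%C.
  move=> /far ij; rewrite (le_trans (cell_sum_inv_le (le_trans M2 ij)))//.
  rewrite lecR /g -invfM -[leRHS]invrK lef_pV2 ?posrE.
  - rewrite invf_div ler_pdivrMr//.
    have -> : ((x - i%:R) ^+ 2 + (y - j%:R) ^+ 2) ^+ 2 * 4 =
      (2 * ((x - i%:R) ^+ 2 + (y - j%:R) ^+ 2)) *
      (2 * ((x - i%:R) ^+ 2 + (y - j%:R) ^+ 2)) by ring.
    have := sqr_ge0 (x - i%:R); have := sqr_ge0 (y - j%:R).
    by move=> ? ?; apply: ler_pM; lra.
  - by rewrite exprn_gt0// (lt_le_trans _ ij)// (lt_le_trans _ M2).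
  - by rewrite invr_gt0 mulr_gt0// invr_gt0 mulr_gt0.
apply: (@le_trans _ _ (\sum_(0 <= i < n) \sum_(0 <= j < n)
    (4 * (g x i * g y j))%:C%C : C)).
  rewrite (le_trans (ler_norm_sum _ _ _))// ler_sum// => i _.
  rewrite (le_trans (ler_norm_sum _ _ _))// big_mkcond ler_sum//= => j _.
  case: ifP => [/bnd//|_]; rewrite ler0c mulr_ge0// mulr_ge0// invr_ge0 ltW//.
under eq_bigr do rewrite -rmorph_sum.
rewrite -rmorph_sum lecR /=; under eq_bigr do rewrite -!mulr_sumr.
rewrite -mulr_sumr -mulr_suml.
have M1 : 1 <= M by lra.
have M8 : 8 / M <= 4^-1 by rewrite ler_pdivrMr; lra.
have gx : \sum_(0 <= i < n) g x i <= 4^-1 := le_trans (sum_inv_le x n M1) M8.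
have gy : \sum_(0 <= i < n) g y i <= 4^-1 := le_trans (sum_inv_le y n M1) M8.
have gx0 : 0 <= \sum_(0 <= i < n) g x i.
  by apply: sumr_ge0 => i _; rewrite invr_ge0 ltW.
have gy0 : 0 <= \sum_(0 <= i < n) g y i.
  by apply: sumr_ge0 => i _; rewrite invr_ge0 ltW.
have := ler_pM gx0 gy0 gx gy; lra.
Qed.


Lemma Im_invc (a b : R) :
  complex.Im ((a +i* b)%C^-1) = - (b / (a ^+ 2 + b ^+ 2)).
Proof. by []. Qed.

Lemma Re_invc (a b : R) :
  complex.Re ((a +i* b)%C^-1) = a / (a ^+ 2 + b ^+ 2).
Proof. by []. Qed.

Lemma Im_sum I (r : seq I) (f : I -> C) :
  complex.Im (\sum_(i <- r) f i) = \sum_(i <- r) complex.Im (f i).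
Proof. by apply: (big_morph (@complex.Im R)) => // -[? ?] []. Qed.

Lemma Re_sum I (r : seq I) (f : I -> C) :
  complex.Re (\sum_(i <- r) f i) = \sum_(i <- r) complex.Re (f i).
Proof. by apply: (big_morph (@complex.Re R)) => // -[? ?] []. Qed.

(** Here p is the distance from z to the line of a side of a block, and q the
    offset of a node along that side; p / (q^2 + p^2) is then the imaginary
    part of the term of that node. *)
Lemma edge_term_ge (M p q : R) : 1 <= M -> M - 2^-1 <= p <= M + 3 / 2 ->
  `|q| <= M + 1 -> (M - 2^-1) / (2 * (M + 3 / 2) ^+ 2) <= p / (q ^+ 2 + p ^+ 2).
Proof.
move=> M1 /andP[p1 p2]; rewrite ler_norml => /andP[q1 q2].
have p0 : 0 < p by lra.
have D0 : 0 < q ^+ 2 + p ^+ 2 by rewrite ltr_wpDl ?sqr_ge0 ?exprn_gt0.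
have E0 : 0 < 2 * (M + 3 / 2) ^+ 2 by rewrite mulr_gt0// exprn_gt0//; lra.
apply: ler_pM => //; [lra|by rewrite invr_ge0 ltW|].
rewrite lef_pV2 ?posrE//.
have : 0 <= (M + 3 / 2 - p) * (M + 3 / 2 + p) by apply: mulr_ge0; lra.
have : 0 <= (M + 3 / 2 - q) * (M + 3 / 2 + q) by apply: mulr_ge0; lra.
by rewrite !expr2; lra.
Qed.

(** The vector from a boundary node to z always points into the block, so that
    every boundary term has a positive imaginary part.  There are 4 (2m+1) of
    them, each of order 1 / (2m) at least. *)
Lemma block_sum_near (m I J : nat) (x y : R) : (2 <= m)%N ->
  (I + m)%:R <= x < (I + m).+1%:R -> (J + m)%:R <= y < (J + m).+1%:R ->
  let block k := \sum_(I <= i < I + m.*2.+1) \sum_(J <= j < J + m.*2.+1)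
    cell_sum k (x - i%:R) (y - j%:R) in
  1 <= complex.Im (block GRing.inv) /\ block dirac0 = 0.
Proof.
rewrite -(ler_nat R) => m2 hx hy block; set M : R := m%:R in m2 *.
set L := m.*2.+1 in block *.
have LE : L%:R = 2 * M + 1 :> R by rewrite /L -addn1 natrD -muln2 natrM mulrC.
have inner (K i : nat) (z : R) : (K + m)%:R <= z < (K + m).+1%:R ->
    (K <= i < K + L)%N -> `|z - i%:R| <= M + 1.
  rewrite -addn1 !natrD => /andP[z1 z2] /andP[]; rewrite -(ler_nat R) => i1.
  rewrite -(addn1 i) -(ler_nat R) !natrD LE => i2.
  by rewrite ler_norml; lra.
have lo (K : nat) (z : R) : (K + m)%:R <= z < (K + m).+1%:R ->
    M - 2^-1 <= z - K%:R + 2^-1 <= M + 3 / 2.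
  by rewrite -addn1 !natrD => /andP[z1 z2]; lra.
have hi (K : nat) (z : R) : (K + m)%:R <= z < (K + m).+1%:R ->
    M - 2^-1 <= - (z - (K + L)%:R + 2^-1) <= M + 3 / 2.
  by rewrite -addn1 !natrD LE => /andP[z1 z2]; lra.
have nz (p : R) : M - 2^-1 <= p <= M + 3 / 2 -> p != 0.
  by move=> /andP[p1 p2]; apply: lt0r_neq0; lra.
split; rewrite /block block_telescope; last first.
  have d0 (p q : R) : (p != 0) || (q != 0) -> dirac0 (p +i* q)%C = 0.
    by rewrite /dirac0 eq_complex /= -negb_and => /negbTE ->.
  have nzN (p : R) : M - 2^-1 <= - p <= M + 3 / 2 -> p != 0.
    by move/nz; rewrite oppr_eq0.
  rewrite big1 ?add0r => [|i _]; last first.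
    by rewrite !d0 ?subrr// ?(nz _ (lo _ _ hy)) ?(nzN _ (hi _ _ hy)) orbT.
  rewrite big1 ?mulr0// => i _.
  by rewrite !d0 ?subrr// ?(nz _ (lo _ _ hx)) ?(nzN _ (hi _ _ hx)).
set kap := (M - 2^-1) / (2 * (M + 3 / 2) ^+ 2).
have kapL : 1 <= 2 * kap * L%:R + 2 * kap * L%:R.
  have E0 : 0 < 2 * (M + 3 / 2) ^+ 2 by rewrite mulr_gt0// exprn_gt0//; lra.
  rewrite -(ler_pM2r E0) mul1r LE.
  have -> : (2 * kap * (2 * M + 1) + 2 * kap * (2 * M + 1)) *
      (2 * (M + 3 / 2) ^+ 2) = 4 * (2 * M + 1) * (M - 2^-1).
    by rewrite -[in RHS](divfK (lt0r_neq0 E0) (M - 2^-1)) -/kap; ring.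
  have : 0 <= M * (M - 2) by apply: mulr_ge0; lra.
  by rewrite !expr2; lra.
have ImD (u v : C) : complex.Im (u + v) = complex.Im u + complex.Im v.
  by case: u v => [? ?] [].
have ReD (u v : C) : complex.Re (u + v) = complex.Re u + complex.Re v.
  by case: u v => [? ?] [].
have Imi (v : C) : complex.Im ('i%C * v) = complex.Re v by rewrite mulrC ImiRe.
have cst (K : nat) (f : nat -> R) :
    (forall i, (K <= i < K + L)%N -> 2 * kap <= f i) ->
    2 * kap * L%:R <= \sum_(K <= i < K + L) f i.
  move=> fk; have -> : 2 * kap * L%:R = \sum_(K <= i < K + L) (2 * kap).
    by rewrite big_const_nat addKn iter_addr_0 mulr_natr.
  by rewrite !big_nat ler_sum.
have M1 : 1 <= M by lra.
apply: (le_trans kapL); rewrite ImD Imi Im_sum Re_sum lerD//; apply: cst => i iK.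
  rewrite ImD (_ : forall u : C, complex.Im (- u) = - complex.Im u); last by case.
  have := edge_term_ge M1 (lo _ _ hy) (inner _ _ _ hx iK).
  have := edge_term_ge M1 (hi _ _ hy) (inner _ _ _ hx iK).
  by rewrite !Im_invc -/kap sqrrN; lra.
rewrite ReD (_ : forall u : C, complex.Re (- u) = - complex.Re u); last by case.
have := edge_term_ge M1 (lo _ _ hx) (inner _ _ _ hy iK).
have := edge_term_ge M1 (hi _ _ hx) (inner _ _ _ hy iK).
rewrite !Re_invc -/kap sqrrN ![_ ^+ 2 + (y - _) ^+ 2]addrC; lra.
Qed.


(** The squares outside the block are far from z, so they perturb the block sum
    by at most 1/4. *)
Lemma lattice_sum_near (m n I J : nat) (s : nat -> nat -> bool) (x y : R) :
  (32 <= m)%N -> (I + m.*2.+1 <= n)%N -> (J + m.*2.+1 <= n)%N ->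
  (I + m)%:R <= x < (I + m).+1%:R -> (J + m)%:R <= y < (J + m).+1%:R ->
  (forall i j, (I <= i < I + m.*2.+1)%N -> (J <= j < J + m.*2.+1)%N -> s i j) ->
  (3 / 4)%:C%C <= `|lattice_sum GRing.inv n s x y| /\
  lattice_sum dirac0 n s x y = 0.
Proof.
move=> m32 In Jn hx hy sIJ; pose L := m.*2.+1.
pose b i j := (I <= i < I + L)%N && (J <= j < J + L)%N.
have split_block k : lattice_sum k n s x y =
    \sum_(I <= i < I + L) \sum_(J <= j < J + L) cell_sum k (x - i%:R) (y - j%:R)
    + lattice_sum k n (fun i j => s i j && ~~ b i j) x y.
  rewrite /lattice_sum; under eq_bigr => i _ do rewrite (bigID (b i)) /=.
  rewrite big_split /=; congr (_ + _).
  rewrite [RHS](big_nat_widen _ _ n)// [RHS](big_nat_widenl _ 0)// [RHS]big_mkcond /=.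
  apply: eq_bigr => i _; case: ifPn => [/andP[iI Ii]|nI]; last first.
    by apply: big_pred0 => j; rewrite /b andbA [(I <= i)%N && _]andbC (negbTE nI) andbF.
  rewrite [RHS](big_nat_widen _ _ n)// [RHS](big_nat_widenl _ 0)//.
  apply: eq_bigl => j; have := sIJ i j; rewrite /b iI Ii /=.
  case: (J <= j)%N; case: (j < J + L)%N => /=; rewrite ?andbF//.
  by move=> /(_ isT isT) ->.
have far i j : s i j && ~~ b i j ->
    m%:R ^+ 2 <= (x - i%:R) ^+ 2 + (y - j%:R) ^+ 2.
  have out (K l : nat) (z : R) : (K + m)%:R <= z < (K + m).+1%:R ->
      ~~ (K <= l < K + L)%N -> m%:R ^+ 2 <= (z - l%:R) ^+ 2.
    rewrite -(addn1 (K + m)) !natrD => /andP[z1 z2].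
    have m0 : 0 <= m%:R :> R by [].
    rewrite negb_and -leqNgt -ltnNge -(ler_nat R) -(addn1 l) -[X in _ || X](ler_nat R).
    rewrite /L -addn1 -muln2 !(natrD, natrM) => /orP[lK|Kl].
      by rewrite ler_sqr ?nnegrE; lra.
    by rewrite -(sqrrN (z - _)) ler_sqr ?nnegrE; lra.
  move=> /andP[_]; rewrite negb_and => /orP[/(out _ _ _ hx) h|/(out _ _ _ hy) h].
    by rewrite (le_trans h)// lerDl sqr_ge0.
  by rewrite (le_trans h)// lerDr sqr_ge0.
have [rest rest0] := lattice_sum_far n m32 far.
have m2 : (2 <= m)%N by apply: leq_trans m32.
have [Im1 blk0] := block_sum_near m2 hx hy.
rewrite !split_block rest0 blk0 addr0; split=> //.
set B := (X in X + _) in Im1 *.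
have Bge : 1%:C%C <= `|B|.
  apply: le_trans (_ : `|complex.Im B|%:C%C <= _).
    by rewrite lecR (le_trans Im1)// ler_norm.
  by rewrite normc_def lecR -sqrtr_sqr ler_wsqrtr// lerDr sqr_ge0.
apply: le_trans (lerB_normD _ _); apply: le_trans (lerB Bge rest).
by rewrite -rmorphB lecR; lra.
Qed.


End lattice.
Arguments dirac0 {R} t.

(** * Partial fractions with simple poles *)

Section partial_fractions.
Variable R : realType.
Local Notation C := (cplx R).

Lemma distinct_roots_prod_XsubC (J : seq C) : uniq J ->
  distinct_roots (\prod_(e <- J) ('X - e%:P)).
Proof.
move=> uJ z; rewrite root_prod_XsubC => zJ.
rewrite (bigD1_seq z)//= mupMl; last first.
  by rewrite -big_filter root_prod_XsubC mem_filter eqxx.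
by rewrite -[X in mup z X]expr1 mup_XsubCX eqxx.
Qed.

(** Repeated poles are merged, and those whose coefficients cancel are dropped.
    As k is total (for the inverse, 0^-1 = 0), this holds at the poles too. *)
Lemma sum_group_poles (r : seq (C * C)) (k : C -> C) (z : C) :
  let coef e := \sum_(u <- r) u.1 * dirac0 (e - u.2) in
  \sum_(u <- r) u.1 * k (z - u.2) =
  \sum_(e <- [seq e <- undup (map snd r) | coef e != 0]) coef e * k (z - e).
Proof.
move=> coef; rewrite big_filter [RHS]big_mkcond /=.
under [RHS]eq_bigr => e _.
  rewrite (_ : (if _ then _ else _) = \sum_(u <- r) u.1 * dirac0 (e - u.2) * k (z - e)).
    over.
  by rewrite -mulr_suml; case: ifPn => // /negbNE/eqP ce0; rewrite [X in X * _]ce0 mul0r.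
rewrite exchange_big /= !big_seq; apply: eq_bigr => u ur.
rewrite (bigD1_seq u.2) ?undup_uniq ?mem_undup ?map_f//= subrr /dirac0 eqxx mulr1.
rewrite big1 ?addr0// => e eu.
by rewrite subr_eq0 (negbTE eu) mulr0 mul0r.
Qed.

(** The roots of p are exactly the poles that survive after merging, hence
    they are simple. *)
Lemma partial_fractions (r : seq (C * C)) :
  let coef e := \sum_(u <- r) u.1 * dirac0 (e - u.2) in
  exists p q : {poly C},
    [/\ forall z, ~~ (root p z && root q z), distinct_roots p,
        (size q < size p)%N, forall z, root p z = (coef z != 0) &
        forall z, coef z = 0 -> q.[z] = p.[z] * \sum_(u <- r) u.1 / (z - u.2)].
Proof.
move=> coef; pose J := [seq e <- undup (map snd r) | coef e != 0].
have uJ : uniq J by rewrite filter_uniq ?undup_uniq.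
have memJ z : (z \in J) = (coef z != 0).
  rewrite mem_filter mem_undup andbC; case: (boolP (z \in _)) => //= zr.
  apply/esym/negbTE; rewrite negbK; apply/eqP.
  rewrite /coef big_seq big1// => u ur; rewrite /dirac0 subr_eq0.
  by case: eqP => [zu|]; [rewrite zu map_f in zr|rewrite mulr0].
pose p : {poly C} := \prod_(e <- J) ('X - e%:P).
pose q : {poly C} :=
  \sum_(e <- J) coef e *: \prod_(e' <- J | e' != e) ('X - e'%:P).
have rootp z : root p z = (coef z != 0) by rewrite root_prod_XsubC memJ.
exists p, q; split=> //.
- move=> z; apply/negP => /andP[]; rewrite root_prod_XsubC => zJ.
  rewrite rootE horner_sum (bigD1_seq z)//= [X in _ + X]big1_seq ?addr0; last first.
    move=> e /andP[ez eJ]; rewrite hornerZ; apply/eqP; rewrite mulf_eq0.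
    by rewrite -rootE -big_filter root_prod_XsubC mem_filter (eq_sym z) ez zJ orbT.
  rewrite hornerZ mulf_eq0 -rootE -big_filter root_prod_XsubC mem_filter eqxx.
  by rewrite orbF; apply/negP; rewrite -memJ.
- exact: distinct_roots_prod_XsubC.
- rewrite /p size_prod_XsubC ltnS.
  rewrite (leq_trans (size_sum _ _ _))//; apply/bigmax_leqP_seq => e eJ _.
  rewrite (leq_trans (size_scale_leq _ _))// -big_filter size_prod_XsubC.
  by rewrite size_filter -(count_predC (pred1 e)) -addn1 addnC leq_add2r -has_count has_pred1.
- move=> z cz; rewrite (sum_group_poles r GRing.inv z) -/coef -/J mulr_sumr.
  rewrite horner_sum !big_seq; apply: eq_bigr => e eJ.
  rewrite hornerZ /p (bigD1_seq e)//= hornerM hornerXsubC.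
  have ze : z - e != 0.
    by rewrite subr_eq0; apply: contraTneq eJ => <-; rewrite memJ cz eqxx.
  by rewrite -/(coef e); field.
Qed.

End partial_fractions.

(** * A rational function of modulus below 1 only near a bounded set *)

Section separation.
Variable R : realType.
Local Notation C := (cplx R).

Lemma pole_list_sum (T : Type) (l : seq T) (P : pred T)
    (F : T -> (C -> C) -> R -> R -> C) :
  (forall t, exists r : seq (C * C), forall k x y,
    F t k x y = \sum_(u <- r) u.1 * k ((x +i* y)%C - u.2)) ->
  exists r : seq (C * C), forall k x y,
    \sum_(t <- l | P t) F t k x y = \sum_(u <- r) u.1 * k ((x +i* y)%C - u.2).
Proof.
move=> /choice[r rF]; exists (flatten [seq r t | t <- l & P t]) => k x y.
rewrite big_flatten big_map big_filter; exact: eq_bigr.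
Qed.

(** The list of poles and coefficients does not depend on the kernel, so that
    it serves for the sum and for the coefficients at the same time. *)
Lemma lattice_sum_poles n (s : nat -> nat -> bool) :
  exists r : seq (C * C), forall k x y,
    lattice_sum k n s x y = \sum_(u <- r) u.1 * k ((x +i* y)%C - u.2).
Proof.
apply: pole_list_sum => i; apply: pole_list_sum => j.
pose e (a b : R) : C := ((i%:R + a) +i* (j%:R + b))%C.
exists [:: (1, e 0 2^-1); (-1, e 0 (- 2^-1)); ('i%C, e (- 2^-1) 0); (- 'i%C, e 2^-1 0)].
move=> k x y; rewrite !big_cons big_nil /= addr0 mul1r mulN1r mulNr.
rewrite /cell_sum mulrBr -addrA; congr (_ + (_ + (_ + _))).
- by congr k; apply/eqP; rewrite eq_complex /=; apply/andP; split; apply/eqP; ring.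
- by congr (- k _); apply/eqP; rewrite eq_complex /=; apply/andP; split; apply/eqP; ring.
- by congr (_ * k _); apply/eqP; rewrite eq_complex /=; apply/andP; split; apply/eqP; ring.
- by congr (- (_ * k _)); apply/eqP; rewrite eq_complex /=; apply/andP; split; apply/eqP; ring.
Qed.

Lemma normc_leE (a b r : R) : 0 <= r ->
  (`|(a +i* b)%C : C| <= r%:C%C) = (a ^+ 2 + b ^+ 2 <= r ^+ 2).
Proof.
move=> r0; rewrite -(@ler_pXn2r _ 2)// ?nnegrE ?ler0c//.
by rewrite sqr_normc_complex -(rmorphXn (real_complex R)) lecR.
Qed.

Lemma normc_ltE (a b r : R) : 0 <= r ->
  (`|(a +i* b)%C : C| < r%:C%C) = (a ^+ 2 + b ^+ 2 < r ^+ 2).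
Proof.
move=> r0; rewrite -(@ltr_pXn2r _ 2)// ?nnegrE ?ler0c//.
by rewrite sqr_normc_complex -(rmorphXn (real_complex R)) ltcR.
Qed.

Lemma normc_le_coord (a b r : R) : 0 <= r ->
  `|(a +i* b)%C : C| <= r%:C%C -> `|a| <= r /\ `|b| <= r.
Proof.
move=> r0; rewrite normc_leE// => ab.
by split; rewrite -(@ler_pXn2r _ 2)// ?nnegrE// real_normK ?num_real//;
  apply: le_trans ab; rewrite ?lerDl ?lerDr sqr_ge0.
Qed.

(** The 2m+1 integers around the integral part of x fit into an index range that
    depends only on m and on a bound of x. *)
Lemma lattice_corner (m n : nat) (x X : R) : m%:R <= x -> x <= X ->
  ((Num.truncn X).+1 + m.+1 <= n)%N ->
  exists I, [/\ (I + m.*2.+1 <= n)%N & (I + m)%:R <= x < (I + m).+1%:R].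
Proof.
move=> mx xX Xn; have x0 : 0 <= x by rewrite (le_trans _ mx).
have /andP[tx xt] := Num.Theory.truncn_itv x0.
have mt : (m <= Num.truncn x)%N by rewrite -ltnS -(ltr_nat R) (le_lt_trans mx).
exists (Num.truncn x - m)%N; rewrite subnK//; split; last by rewrite tx xt.
have : (Num.truncn x < (Num.truncn X).+1)%N.
  by rewrite -(ltr_nat R) (le_lt_trans tx)// (le_lt_trans xX)// truncnS_gt.
by move: Xn mt; clear; lia.
Qed.

(** The lattice function, rescaled to a mesh h: it selects the squares with
    center within 66 h of K, so that the whole block of half-width m = 32
    around a point of K is selected, and a point at distance at least
    98 h = d from K is at distance at least 32 h from all selected squares. *)
Lemma rational_separation (K : set C) (B d : R) : 0 < d -> K !=set0 ->
  (forall z, K z -> `|z| <= B%:C%C) ->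
  exists p q : {poly C},
    [/\ rational_pair p q, distinct_roots p, (size q < size p)%N,
        K `<=` lemniscate p q &
        forall z, lemniscate p q z -> exists2 w, K w & `|z - w| < d%:C%C].
Proof.
move=> d0 [w0 Kw0] KB; have B0 : 0 <= B.
  by rewrite -ler0c (le_trans _ (KB _ Kw0)).
(* m = 32 makes the bound (8 / m)^2 * 4 on the far squares equal to 1/4, and
   66 = 2 (m + 1) bounds the distance to the cells of the block. *)
pose m := 32%N; pose h := d / 98; have h0 : 0 < h by rewrite divr_gt0.
(* Translating by rho (1 + i) moves K into the positive quadrant, with room
   for a block around each of its points. *)
pose rho := B + m%:R * h.
pose sc (t : R) := (t + rho) / h.
pose X := (B + rho) / h.
pose n := ((Num.truncn X).+1 + m.+1)%N.
pose s (i j : nat) := `[< exists2 w : C, K w &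
  (sc (complex.Re w) - i%:R) ^+ 2 + (sc (complex.Im w) - j%:R) ^+ 2 <= 66 ^+ 2 >].
have [r rE] := lattice_sum_poles n s.
pose o : C := ((- rho) +i* (- rho))%C.
have scE (z : C) : (sc (complex.Re z) +i* sc (complex.Im z))%C = (z - o) / h%:C%C.
  rewrite -(fmorphV (real_complex R)) /sc /o; apply/eqP.
  rewrite eq_complex; case: z => x y /=; apply/andP; split; apply/eqP; ring.
(* Twice the lattice sum in the original coordinate: its modulus is at least
   3/2 on K and at most 1/2 far from K. *)
pose r' := [seq (2 * h%:C%C * u.1, o + h%:C%C * u.2) | u <- r].
have hC : h%:C%C != 0 :> C by rewrite fmorph_eq0 gt_eqF.
have FE (z : C) : \sum_(u <- r') u.1 / (z - u.2) =
    2 * lattice_sum GRing.inv n s (sc (complex.Re z)) (sc (complex.Im z)).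
  rewrite rE big_map mulr_sumr; apply: eq_bigr => u _ /=; rewrite scE.
  have -> : z - (o + h%:C%C * u.2) = h%:C%C * ((z - o) / h%:C%C - u.2) by field.
  by rewrite invfM; move: ((z - o) / h%:C%C - u.2)^-1 => Y; field.
have cE (z : C) : \sum_(u <- r') u.1 * dirac0 (z - u.2) =
    2 * h%:C%C * lattice_sum dirac0 n s (sc (complex.Re z)) (sc (complex.Im z)).
  rewrite rE big_map mulr_sumr; apply: eq_bigr => u _ /=; rewrite scE.
  have -> : z - (o + h%:C%C * u.2) = h%:C%C * ((z - o) / h%:C%C - u.2) by field.
  by rewrite /dirac0 mulf_eq0 (negbTE hC) mulrA.
have near z : K z -> (3 / 2)%:C%C <= `|\sum_(u <- r') u.1 / (z - u.2)| /\
    \sum_(u <- r') u.1 * dirac0 (z - u.2) = 0.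
  move=> Kz; rewrite FE cE.
  have cornr (t : R) : `|t| <= B -> exists I,
      [/\ (I + m.*2.+1 <= n)%N & (I + m)%:R <= sc t < (I + m).+1%:R].
    rewrite ler_norml => /andP[t1 t2]; apply: (@lattice_corner m n (sc t) X) => //.
      by rewrite /sc ler_pdivlMr// /rho; lra.
    by rewrite /sc /X ler_pM2r ?invr_gt0// lerD2r.
  have zC : z = (complex.Re z +i* complex.Im z)%C by case: z Kz.
  have [zx zy] := normc_le_coord B0 (eq_ind _ (fun z => `|z| <= B%:C%C) (KB _ Kz) _ zC).
  have [I [In hx]] := cornr _ zx; have [J [Jn hy]] := cornr _ zy.
  have box (P i : nat) (t : R) : (P + m)%:R <= t < (P + m).+1%:R ->
      (P <= i < P + m.*2.+1)%N -> (t - i%:R) ^+ 2 <= 33 ^+ 2.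
    rewrite -(addn1 (P + m)) !natrD => /andP[t1 t2] /andP[].
    rewrite -(ler_nat R) -[X in _ -> is_true X -> _](ler_nat R) -(addn1 i) -addn1 -muln2.
    rewrite !(natrD, natrM) => i1 i2.
    have : 0 <= (33 - (t - i%:R)) * (33 + (t - i%:R)).
      by apply: mulr_ge0; rewrite /m in t1 t2 i1 i2; lra.
    by rewrite -subr_sqr subr_ge0.
  have sIJ i j : (I <= i < I + m.*2.+1)%N -> (J <= j < J + m.*2.+1)%N -> s i j.
    move=> iI jJ; apply/asboolP; exists z => //.
    by have := box _ _ _ hx iI; have := box _ _ _ hy jJ; lra.
  have [l1 ->] := lattice_sum_near (leqnn 32) In Jn hx hy sIJ.
  rewrite mulr0 normrM normr_nat; split=> //.
  have := ler_wpM2l (ler0n _ 2) l1; apply: le_trans.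
  by rewrite -(rmorph_nat (real_complex R)) -rmorphM lecR; lra.
have far z : ~ (exists2 w, K w & `|z - w| < d%:C%C) ->
    `|\sum_(u <- r') u.1 / (z - u.2)| <= (2^-1)%:C%C /\
    \sum_(u <- r') u.1 * dirac0 (z - u.2) = 0.
  move=> nK; rewrite FE cE.
  have sfar i j : s i j -> m%:R ^+ 2 <= (sc (complex.Re z) - i%:R) ^+ 2
       + (sc (complex.Im z) - j%:R) ^+ 2.
    move=> /asboolP[w Kw wij]; rewrite leNgt; apply/negP => zij; apply: nK.
    exists w => //; pose g : C := (i%:R +i* j%:R)%C.
    have -> : z - w = h%:C%C * (((z - o) / h%:C%C - g) - ((w - o) / h%:C%C - g)).
      by field.
    rewrite normrM normc_def /= expr0n addr0 sqrtr_sqr (gtr0_norm h0).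
    have zg : `|(z - o) / h%:C%C - g| < m%:R%:C%C by rewrite -scE normc_ltE.
    have wg : `|(w - o) / h%:C%C - g| <= 66%:C%C by rewrite -scE normc_leE.
    have -> : d%:C%C = h%:C%C * (m%:R%:C%C + 66%:C%C) :> C.
      by rewrite -rmorphD -rmorphM /h; congr (_ %:C)%C; rewrite /m; field.
    rewrite ltr_pM2l ?ltcR// (le_lt_trans (ler_normB _ _))//.
    by rewrite ltr_leD.
  have [l1 ->] := lattice_sum_far n (leqnn 32) sfar.
  rewrite mulr0 normrM normr_nat; split=> //.
  have := ler_wpM2l (ler0n _ 2) l1; move/le_trans; apply.
  by rewrite -(rmorph_nat (real_complex R)) -rmorphM lecR; lra.
have [p [q [pq dp sqp rp pqF]]] := partial_fractions r'.
have inside : K `<=` lemniscate p q.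
  move=> z /near[Fz cz]; have pz : p.[z] != 0.
    by rewrite -rootE rp cz eqxx.
  have F1 : 1 < `|\sum_(u <- r') u.1 / (z - u.2)|.
    by apply: lt_le_trans Fz; rewrite ltcR; lra.
  have F0 : \sum_(u <- r') u.1 / (z - u.2) != 0.
    by rewrite -normr_gt0 (lt_trans _ F1).
  rewrite /lemniscate /= pqF//; split; first by rewrite mulf_neq0.
  by rewrite invfM mulrA mulfV// mul1r normfV invf_lt1// (lt_trans _ F1).
exists p, q; split => //.
  split=> //; apply/eqP => q0; have [+ _] := inside _ Kw0.
  by rewrite q0 horner0 eqxx.
move=> z [qz lz]; apply: contrapT => /far[Fz cz].
move: qz lz; rewrite pqF// mulf_eq0 negb_or => /andP[pz F0].
rewrite invfM mulrA mulfV// mul1r normfV invf_lt1 ?normr_gt0//.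
by move=> /lt_le_trans/(_ Fz); rewrite ltcR; lra.
Qed.

End separation.

(** * Compact sets, lemniscates and their components *)

Lemma continuous_horner_numField (K : numFieldType) (p : {poly K}) :
  continuous (horner p : K -> K).
Proof.
elim/poly_ind: p => [|p c IH] z.
  have -> : horner (0 : {poly K}) = fun=> 0 by apply/funext => u; rewrite horner0.
  exact: cst_continuous.
have -> : horner (p * 'X + c%:P) = (horner p \* id) \+ cst c.
  by apply/funext => u; rewrite hornerMXaddC.
apply: (@continuousD K K K); last exact: cst_continuous.
exact: (@continuousM K K _ _ _ (IH z) (@cvg_id _ _)).
Qed.

Section topology.
Variable R : realType.
Local Notation C := (cplx R).

Lemma continuous_Complex : continuous (fun t : R * R => (t.1 +i* t.2)%C : C).
Proof.
move=> [a b]; apply/cvgrPdist_lt => -[e e'].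
rewrite ltcE /= => /andP[/eqP -> e0].
have e2 : 0 < e / 2 by rewrite divr_gt0.
exists (ball a (e / 2), ball b (e / 2)) => /=.
  by split; apply: nbhsx_ballx.
move=> [a' b'] []; rewrite -!ball_normE /= => aa bb.
rewrite normc_ltE ?ltW//.
have : `|a - a'| ^+ 2 < (e / 2) ^+ 2 by rewrite ltr_pXn2r ?nnegrE// ltW.
have : `|b - b'| ^+ 2 < (e / 2) ^+ 2 by rewrite ltr_pXn2r ?nnegrE// ltW.
rewrite !real_normK ?num_real// => bb2 aa2.
have e4 : (e / 2) ^+ 2 = e ^+ 2 / 4 by field.
by have := exprn_gt0 2 e0; rewrite e4 in aa2 bb2; lra.
Qed.

Lemma bounded_closed_compact_cplx (K : set C) (B : C) :
  closed K -> (forall z, K z -> `|z| <= B) -> compact K.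
Proof.
move=> clK KB; have [->|/set0P[w Kw]] := eqVneq K set0; first exact: compact0.
have : 0 <= B by rewrite (le_trans _ (KB _ Kw)).
case: B KB => B B' KB; rewrite lecE /= => /andP[/eqP B'0 B0]; subst B'.
pose Q : set C := (fun t : R * R => (t.1 +i* t.2)%C : C) @`
  (`[- B, B]%classic `*` `[- B, B]%classic).
apply: (@subclosed_compact _ K Q) => //.
  apply: continuous_compact; last exact/compact_setX/segment_compact/segment_compact.
  exact/continuous_subspaceT/continuous_Complex.
move=> [a b] /KB /(normc_le_coord B0)[a1 b1]; exists (a, b) => //.
by split; rewrite /= in_itv /= -ler_norml.
Qed.

Lemma open_lemniscate (p q : {poly C}) : open (lemniscate p q).
Proof.
have lemE z : lemniscate p q z <-> `|p.[z]| < `|q.[z]|.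
  split=> [[qz]|pq]; first by rewrite normrM normfV ltr_pdivrMr ?normr_gt0// mul1r.
  have qz : q.[z] != 0 by rewrite -normr_gt0 (le_lt_trans _ pq).
  by split=> //; rewrite normrM normfV ltr_pdivrMr ?normr_gt0// mul1r.
rewrite openE => z /lemE pq.
have e0 : 0 < (`|q.[z]| - `|p.[z]|) / 2 by rewrite divr_gt0// subr_gt0.
have /cvgrPdist_lt/(_ _ e0) pcont := @continuous_horner_numField C p z.
have /cvgrPdist_lt/(_ _ e0) qcont := @continuous_horner_numField C q z.
rewrite /interior /=; apply: filterS2 pcont qcont => u pu qu; apply/lemE.
have pu' : `|p.[u]| < `|p.[z]| + (`|q.[z]| - `|p.[z]|) / 2.
  by rewrite -ltrBlDl (le_lt_trans (lerB_dist _ _))// distrC.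
apply: (lt_trans pu').
have -> : `|p.[z]| + (`|q.[z]| - `|p.[z]|) / 2 =
          `|q.[z]| - (`|q.[z]| - `|p.[z]|) / 2 by field.
by rewrite ltrBlDr -ltrBlDl (le_lt_trans (lerB_dist _ _)).
Qed.


(** A component of V that meets N1 has an open trace on N1, which is also
    closed as the trace of the complement of N2; so it lies in N1. *)
Lemma union_of_components_separated (T : topologicalType) (V N1 N2 : set T) :
  open N1 -> open N2 -> N1 `&` N2 = set0 -> V `<=` N1 `|` N2 ->
  union_of_components V (V `&` N1).
Proof.
move=> oN1 oN2 N12 VN; exists (V `&` N1); first by move=> x [].
apply/seteqP; split=> [x [Vx Nx]|y [x [Vx Nx] xy]].
  by exists x => //; exact: connected_component_refl.
split; first exact: connected_component_sub xy.
have := @component_connected _ V x => /(_ (connected_component V x `&` N1)) cc.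
suff : (connected_component V x `&` N1) y by case.
rewrite cc//; first by exists x; split => //; exact: connected_component_refl.
  by exists N1.
exists (~` N2); first exact: open_closedC.
apply/seteqP; split=> z [Vz Nz]; split=> //.
  by move=> N2z; have : set0 z by rewrite -N12.
by have [//|//] := VN z (connected_component_sub Vz).
Qed.

Definition neighborhood (K : set C) (d : R) : set C :=
  [set z | exists2 w, K w & `|z - w| < d%:C%C].

Lemma open_neighborhood K d : open (neighborhood K d).
Proof.
rewrite openE => z [w Kw zw]; apply/nbhs_ballP.
exists (d%:C%C - `|z - w|); first by rewrite /= subr_gt0.
move=> u; rewrite -ball_normE /= => zu; exists w => //.
rewrite (le_lt_trans (ler_distD z _ _))// distrC.
by rewrite -ltrBrDr.
Qed.

Lemma Re_norm (z : C) : (complex.Re `|z|)%:C%C = `|z|.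
Proof. by rewrite RRe_real// normr_real. Qed.

Lemma dist_neighborhoods (K1 K2 : set C) (d e : R) (u v : C) :
  (forall x y, K1 x -> K2 y -> e < complex.Re `|x - y|) ->
  neighborhood K1 d u -> neighborhood K2 d v -> e - d - d < complex.Re `|u - v|.
Proof.
move=> K12 [x K1x ux] [y K2y vy]; have := K12 _ _ K1x K2y.
have : `|x - y| <= `|u - x| + `|u - v| + `|v - y|.
  rewrite (le_trans (ler_distD u _ _))// -addrA lerD//; first by rewrite distrC.
  exact: ler_distD.
move: ux vy; rewrite -(Re_norm (u - x)) -(Re_norm (v - y)) -(Re_norm (u - v)).
rewrite -(Re_norm (x - y)) /= -!rmorphD lecR !ltcR; lra.
Qed.

End topology.

(** * The two groups of components *)

Lemma set_dist_ge (R : realType) (S T : set (cplx R)) (e : R) :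
  (forall x y, S x -> T y -> e <= complex.Re `|x - y|) -> (e%:E <= set_dist S T)%E.
Proof.
move=> ST; apply: le_ereal_inf_tmp => _ [x Sx [y Ty <-]].
by rewrite lee_fin ST.
Qed.

(** The neighborhoods of radius 3 eps / 4 of two sets more than 2 eps apart are
    more than eps / 2 apart, which is the gap left between V1 and V2. *)
Lemma lemniscate_separation (R : realType) (K1 K2 : set (cplx R)) (B eps : R) :
  K1 `|` K2 !=set0 -> (forall z, (K1 `|` K2) z -> `|z| <= B%:C%C) -> 0 < eps ->
  (forall x y, K1 x -> K2 y -> eps * 2 < complex.Re `|x - y|) ->
  exists p q : {poly cplx R},
    [/\ rational_pair p q, distinct_roots p, (size q < size p)%N &
      exists V1 V2 : set (cplx R),
        [/\ lemniscate p q = V1 `|` V2 /\ V1 `&` V2 = set0,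
            union_of_components (lemniscate p q) V1 /\
              union_of_components (lemniscate p q) V2,
            K1 `<=` V1° /\ K2 `<=` V2° &
            ((eps / 2)%:E <= set_dist V1 V2)%E]].
Proof.
move=> K0 KB e0 K12; have d0 : 0 < 3 / 4 * eps by rewrite mulr_gt0.
have [p [q [pq dp sqp KV Vnb]]] := rational_separation d0 K0 KB.
exists p, q; split=> //; set V := lemniscate p q in KV Vnb *.
pose N1 := neighborhood K1 (3 / 4 * eps); pose N2 := neighborhood K2 (3 / 4 * eps).
have VN : V `<=` N1 `|` N2.
  by move=> z /Vnb[w [K1w|K2w] zw]; [left|right]; exists w.
have N12 u v : N1 u -> N2 v -> eps / 2 < complex.Re `|u - v|.
  by move=> N1u N2v; have := dist_neighborhoods K12 N1u N2v; lra.
have N120 : N1 `&` N2 = set0.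
  apply/seteqP; split=> // u [N1u N2u]; have := N12 _ _ N1u N2u.
  by rewrite subrr normr0 /= => h; exfalso; lra.
have oV : open V := @open_lemniscate R p q.
have oN1 : open N1 := @open_neighborhood _ _ _.
have oN2 : open N2 := @open_neighborhood _ _ _.
have KN (K : set (cplx R)) : K `<=` neighborhood K (3 / 4 * eps).
  by move=> z Kz; exists z => //; rewrite subrr normr0 ltcR.
exists (V `&` N1), (V `&` N2); split; [split|split|split|].
- by rewrite -setIUr; apply/esym/setIidPl.
- by rewrite setIACA setIid N120 setI0.
- exact: union_of_components_separated VN.
- by apply: (@union_of_components_separated _ V N2 N1) => //; rewrite 1?setIC 1?setUC.
- rewrite (iffLR (interior_id _) (openI oV oN1)) => z Kz; split; last exact: KN.
  by apply: KV; left.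
- rewrite (iffLR (interior_id _) (openI oV oN2)) => z Kz; split; last exact: KN.
  by apply: KV; right.
- by apply: set_dist_ge => x y [_ Nx] [_ Ny]; apply/ltW/N12.
Qed.

Theorem proposition4p1 (R : realType)
    (X Y : completeNormedModType (cplx R))
    (A : {linear X -> X}) (B : {linear Y -> Y}) (C : {linear Y -> X})
    (hA : bounded_op A) (hB : bounded_op B) (hC : bounded_op C)
    (hAB : spectrum A `&` spectrum B = set0)
    (eps : R) (eps_gt0 : 0 < eps)
    (heps : (eps%:E < set_dist (spectrum A) (spectrum B) * (2^-1)%:E)%E) :
  exists p q : {poly cplx R},
    [/\ rational_pair p q, distinct_roots p, (size q < size p)%N &
      exists V1 V2 V0 : set (cplx R),
        [/\ [/\ lemniscate p q = V1 `|` V2 `|` V0,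
                V1 `&` V2 = set0, V1 `&` V0 = set0 & V2 `&` V0 = set0],
            [/\ union_of_components (lemniscate p q) V1,
                union_of_components (lemniscate p q) V2 &
                union_of_components (lemniscate p q) V0],
            [/\ compactly_contained (spectrum A) V1,
                compactly_contained (spectrum B) V2 &
                V0 `&` spectrum (upper_triangular A B C) = set0] &
            [/\ ((eps / 2)%:E <= set_dist V1 V2)%E,
                ((eps / 2)%:E <= set_dist V1 V0)%E &
                ((eps / 2)%:E <= set_dist V2 V0)%E]]].
Proof.
have [a a0 bA] := spectrum_le_bound hA; have [b b0 bB] := spectrum_le_bound hB.
have cA : compact (spectrum A).
  exact: bounded_closed_compact_cplx (@closed_spectrum _ _ A) bA.
have cB : compact (spectrum B).
  exact: bounded_closed_compact_cplx (@closed_spectrum _ _ B) bB.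
have dAB x y : spectrum A x -> spectrum B y -> eps * 2 < complex.Re `|x - y|.
  move=> Ax By; have : (set_dist (spectrum A) (spectrum B) <= (complex.Re `|x - y|)%:E)%E.
    by apply: ereal_inf_lbound; exists x => //; exists y.
  move=> /(lee_wpmul2r (_ : 0%E <= (2^-1)%:E)%E); rewrite lee_fin => /(_ ltac:(lra)).
  move=> /(lt_le_trans heps); rewrite -EFinM lte_fin; lra.
(* Both spectra are empty when both spaces are trivial.  A lemniscate is never
   empty, so it is then drawn around the origin instead. *)
have [Z [Z1 Z2]] : exists Z : set (cplx R), [/\ spectrum A `<=` Z,
    Z `|` spectrum B !=set0,
    forall z, (Z `|` spectrum B) z -> `|z| <= (complex.Re (a + b))%:C%C &
    forall x y, Z x -> spectrum B y -> eps * 2 < complex.Re `|x - y|].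
  have ab0 : 0 <= a + b by rewrite addr_ge0.
  have -> : (complex.Re (a + b))%:C%C = a + b by rewrite RRe_real// ger0_real.
  have [s0|/set0P s1] := eqVneq (spectrum A `|` spectrum B) set0.
    have [A0 B0] : spectrum A = set0 /\ spectrum B = set0.
      by move/seteqP: s0 => [s0 _]; split; apply/seteqP; split => // z sz; apply: (s0 z); [left|right].
    exists [set 0]; rewrite A0 B0 setU0; split=> //; first by exists 0.
    by move=> _ ->; rewrite normr0.
  exists (spectrum A); split=> // z [/bA za|/bB zb].
    by rewrite (le_trans za)// lerDl.
  by rewrite (le_trans zb)// lerDr.
move=> ZB dZB.
have [p [q [pq dp sqp [V1 [V2 [[VE V12] [cV1 cV2] [K1V K2V] dV]]]]]] :=
  lemniscate_separation Z2 ZB eps_gt0 dZB.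
exists p, q; split=> //; exists V1, V2, set0; split.
- by rewrite setU0 !setI0.
- by split=> //; exists set0 => //; rewrite bigcup_set0.
- by split; [split=> //; exact: subset_trans K1V|split|rewrite set0I].
- by split=> //; apply: set_dist_ge => x y _ [].
Qed.
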